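(* The Connes' differential $B_\bullet:HH_\bullet(A)\to HH_{\bullet+1}(A)$ is determined by (i) $B_0(\alpha_0(n))=n\,\alpha_1(n)$, $B_0(\beta_0(n))=n\,\beta_1(n)$, $B_0(\gamma_0(n))=n\,\gamma_1(n)$; (ii) $B_0(\overline\epsilon_0(n_{1,p};m_{1,p}))=\theta_1(n_{1,p};m_{1,p})$; (iii) $B_0(\zeta_0)=0$; where $p,n,n_1,\dots,n_p,m_1,\dots,m_p\ge 1$ are positive integers.
   Context: $\mathbf{k}$ is a field of characteristic $0$, $A=\mathbf{k}\langle x,y,z\rangle/(x^2+yx,\,xz,\,zy)$, $A^e=A\otimes A^{\mathrm{op}}$, $HH_n(A)=\mathrm{Tor}_n^{A^e}(A,A)$; one has $HH_n(A)=0$ for $n\neq 0,1$, so only $B_0:HH_0(A)\to HH_1(A)$ can be nonzero. The notation $n_{1,p}$ stands for $n_1,\dots,n_p$. Connes' differential is defined on the reduced Hochschild chain complex $C_n(A)=A\otimes\overline A^{\otimes n}$, $\overline A=A/\mathbf{k}1$; in degree $0$ it is $B(a)=1\otimes\overline a$. $A$ is Koszul, and $HH_1(A)$ is identified with $\ker d_1/\mathrm{im}\,d_2$ in the Koszul complex $A\otimes V_2\xrightarrow{d_2}A\otimes V_1\xrightarrow{d_1}A$, with $V_1=\mathbf{k}\{x,y,z\}$, $V_2=\mathbf{k}\{(x+y)x,xz,zy\}$, $d_1(a\otimes p)=ap-pa$, $d_2(a\otimes (x+y)x)=a(x+y)\otimes x+xa\otimes x+xa\otimes y$, $d_2(b\otimes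 xz)=bx\otimes z+zb\otimes x$, $d_2(c\otimes zy)=cz\otimes y+yc\otimes z$; the identification with bar-complex homology is induced by the inclusion $A\otimes V_1\to A\otimes\overline A$, $a\otimes v\mapsto a\otimes\overline v$. Elements of $HH_0(A)=A/[A,A]$: $\zeta_0=1$, $\alpha_0(n)=x^n$, $\beta_0(n)=y^n$, $\gamma_0(n)=z^n$, and $\overline\epsilon_0(n_{1,p};m_{1,p})$ is the class of $xy^{n_1}z^{m_1}xy^{n_2}z^{m_2}\cdots xy^{n_p}z^{m_p}$; together they form a basis of $HH_0(A)$ (with $\overline\epsilon_0$ indexed up to cyclic permutation of the pairs $(n_i,m_i)$). Elements of $HH_1(A)$ (classes of): $\alpha_1(n)=x^{n-1}\otimes x$, $\beta_1(n)=y^{n-1}\otimes y$, $\gamma_1(n)=z^{n-1}\otimes z$, $\theta_1(n_{1,p};m_{1,p})=\sum wu\otimes v$, the sum being over all factorizations $uvw$ of the word $xy^{n_1}z^{m_1}\cdots xy^{n_p}z^{m_p}$ with $v\in\{x,y,z\}$ a letter and $u,w$ possibly empty words. *)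

(* Defs.v *)
From HB Require Import structures.
From mathcomp Require Import all_boot all_order all_algebra.
From mathcomp Require Import boolp finmap.
From mathcomp Require Import monalg.

Set Implicit Arguments.
Unset Strict Implicit.
Unset Printing Implicit Defensive.

Import GRing.Theory.
Local Open Scope ring_scope.
Local Open Scope quotient_scope.

(** * Quotients of (possibly infinite-dimensional) vector spaces *)

(* [lquot S] is the quotient of V by the subspace spanned by the set S. *)
Section LinearQuotient.
Context {k : fieldType} {V : lmodType k} (S : V -> Prop).

Inductive in_lspan : V -> Prop :=
  | in_lspan0 : in_lspan 0
  | in_lspanD a u v of S u & in_lspan v : in_lspan (a *: u + v).

Definition lspan : pred V := fun v => `[< in_lspan v >].

Lemma lspan_submod_closed : submod_closed lspan.
Proof.
split=> [|a u v]; first exact/asboolP/in_lspan0.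
move=> /asboolP uS /asboolP vS; apply/asboolP.
elim: uS => [|b u1 u2 Su1 _ IH]; first by rewrite scaler0 add0r.
by rewrite scalerDr scalerA -addrA; apply: in_lspanD.
Qed.

HB.instance Definition _ :=
  GRing.isSubmodClosed.Build k V lspan lspan_submod_closed.

Definition lspan_zmod := GRing.ZmodClosed.clone V lspan _.

Definition lquot := Quotient.quot lspan_zmod.

HB.instance Definition _ := GRing.Zmodule.on lquot.
HB.instance Definition _ := EqQuotient.on lquot.

Definition lcls (v : V) : lquot := \pi_lquot v.

Lemma lcls_surj (q : lquot) : q = lcls (repr q).
Proof. by rewrite /lcls reprK. Qed.

Lemma lcls_eq (u v : V) : lcls u = lcls v <-> in_lspan (u - v).
Proof.
split=> [/eqP|h]; first by rewrite -(Quotient.idealrBE lspan_zmod) => /asboolP.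
by apply/eqP; rewrite -(Quotient.idealrBE lspan_zmod); apply/asboolP.
Qed.

Lemma lclsB : {morph lcls : u v / u - v}.
Proof. by move=> u v; rewrite /lcls !piE. Qed.

Definition lquot_scale (a : k) (q : lquot) : lquot := lcls (a *: repr q).

Lemma lquot_scaleE a v : lquot_scale a (lcls v) = lcls (a *: v).
Proof.
apply/lcls_eq; rewrite -scalerBr.
have /lcls_eq h : lcls (repr (lcls v)) = lcls v by rewrite -lcls_surj.
elim: h => [|b u w Su _ IH]; first by rewrite scaler0; constructor.
by rewrite scalerDr scalerA; constructor.
Qed.

Lemma lclsD : {morph lcls : u v / u + v}.
Proof. by move=> u v; rewrite /lcls !piE. Qed.

Fact lquot_scaleA a b q :
  lquot_scale a (lquot_scale b q) = lquot_scale (a * b) q.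
Proof. by rewrite (lcls_surj q) !lquot_scaleE scalerA. Qed.
Fact lquot_scale1 : left_id 1 lquot_scale.
Proof. by move=> q; rewrite (lcls_surj q) lquot_scaleE scale1r. Qed.
Fact lquot_scaleDr : right_distributive lquot_scale +%R.
Proof.
move=> a p q; rewrite (lcls_surj p) (lcls_surj q) -lclsD !lquot_scaleE.
by rewrite scalerDr lclsD.
Qed.
Fact lquot_scaleDl q : {morph lquot_scale^~ q : a b / a + b}.
Proof.
by move=> a b; rewrite (lcls_surj q) !lquot_scaleE scalerDl lclsD.
Qed.

HB.instance Definition _ := GRing.Zmodule_isLmodule.Build k lquot
  lquot_scaleA lquot_scale1 lquot_scaleDr lquot_scaleDl.

Fact lcls_linear : linear lcls.
Proof. by move=> a u v; rewrite lclsD -lquot_scaleE. Qed.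

HB.instance Definition _ := GRing.isLinear.Build k V lquot _ lcls lcls_linear.

Lemma lcls_eq0 v : S v -> lcls v = 0.
Proof.
move=> Sv; rewrite -(linear0 lcls); apply/lcls_eq.
rewrite subr0; have := in_lspanD 1 Sv in_lspan0; by rewrite scale1r addr0.
Qed.

End LinearQuotient.

Section LinearQuotientLift.
Context {k : fieldType} {V : lmodType k} (S : V -> Prop) {W : lmodType k}.
Context (f : {linear V -> W}).

Definition lquot_lift of (forall v, S v -> f v = 0) : lquot S -> W :=
  fun q => f (repr q).

Lemma lquot_liftE fS v : lquot_lift fS (lcls S v) = f v.
Proof.
have /lcls_eq h : lcls S (repr (lcls S v)) = lcls S v by rewrite -lcls_surj.
apply/eqP; rewrite -subr_eq0 -linearB; apply/eqP.
elim: h => [|a u w Su _ IH]; first exact: linear0.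
by rewrite linearP IH addr0 fS // scaler0.
Qed.

Fact lquot_lift_linear fS : linear (lquot_lift fS).
Proof.
move=> a p q; rewrite (lcls_surj p) (lcls_surj q) -linearP !lquot_liftE.
by rewrite linearP.
Qed.

HB.instance Definition _ fS :=
  GRing.isLinear.Build k (lquot S) W _ (lquot_lift fS) (lquot_lift_linear fS).

End LinearQuotientLift.

(** * Linear extension from the free vector space [{malg k[K]}] on K *)

Section FreeLift.
Context {k : fieldType} {K : choiceType} {W : lmodType k} (f : K -> W).

Definition free_lift (g : {malg k[K]}) : W := \sum_(i <- msupp g) g@_i *: f i.

Lemma free_liftEw (d : {fset K}) g : (msupp g `<=` d)%fset ->
  free_lift g = \sum_(i <- d) g@_i *: f i.
Proof.
move=> le; rewrite /free_lift [LHS](big_fset_incl _ le) => //= x xd.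
by move=> /mcoeff_outdom ->; rewrite scale0r.
Qed.

Lemma free_lift_linear : linear free_lift.
Proof.
move=> a g h; pose d := (msupp g `|` msupp h `|` msupp (a *: g + h))%fset.
rewrite !(@free_liftEw d) ?fsubsetUr //; last first.
- by rewrite /d -fsetUA fsubsetUl.
- by rewrite /d fsetUAC fsubsetUr.
rewrite scaler_sumr -big_split /=; apply: eq_bigr => i _.
by rewrite mcoeffD mcoeffZ scalerDl scalerA.
Qed.

HB.instance Definition _ :=
  GRing.isLinear.Build k {malg k[K]} W _ free_lift free_lift_linear.

Lemma free_liftU i : free_lift << i >> = f i.
Proof.
by rewrite (free_liftEw msuppU_le) big_seq_fset1 mcoeffUU scale1r.
Qed.

End FreeLift.

Lemma free_ext (k : fieldType) (K : choiceType) (W : lmodType k)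
    (f g : {linear {malg k[K]} -> W}) :
  (forall i, f << i >> = g << i >>) -> f =1 g.
Proof.
move=> fg u; rewrite (monalgE u) !linear_sum; apply: eq_bigr => i _ /=.
have -> : << u@_i *g i >> = u@_i *: << i >> :> {malg k[K]}.
  by apply/malgP => j; rewrite mcoeffZ !mcoeffU mulr_natr.
by rewrite !linearZ fg.
Qed.

(** * Tensor products over k *)

Section Tensor.
Context {k : fieldType} (U V : lmodType k).

Inductive tensor_rel : {malg k[(U * V)%type]} -> Prop :=
  | tensor_rell a u u' v :
      tensor_rel (<< (a *: u + u', v) >> - (a *: << (u, v) >> + << (u', v) >>))
  | tensor_relr a u v v' :
      tensor_rel (<< (u, a *: v + v') >> - (a *: << (u, v) >> + << (u, v') >>)).

Definition tensor := lquot tensor_rel.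
HB.instance Definition _ := GRing.Lmodule.on tensor.

End Tensor.

(* Locked, as is [bar] below, to keep unification from unfolding the quotient. *)
HB.lock Definition tens (k : fieldType) (U V : lmodType k) (u : U) (v : V) :
  tensor U V := lcls (@tensor_rel k U V) << (u, v) >>.
Arguments tens {k U V} u v.

Section TensorTheory.
Context {k : fieldType} {U V : lmodType k}.
Implicit Types (u : U) (v : V).

Lemma tens_linearl v : linear (fun u : U => tens u v).
Proof.
move=> a u u'; rewrite !tens.unlock; apply/eqP; rewrite -subr_eq0 -!linearP -linearB.
by apply/eqP/lcls_eq0; exact: tensor_rell.
Qed.

Lemma tens_linearr u : linear (@tens k U V u).
Proof.
move=> a v v'; rewrite !tens.unlock; apply/eqP; rewrite -subr_eq0 -!linearP -linearB.
by apply/eqP/lcls_eq0; exact: tensor_relr.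
Qed.

HB.instance Definition _ u := GRing.isLinear.Build k V (tensor U V) _ (@tens k U V u)
  (tens_linearr u).

Lemma tensDl u u' v : tens (u + u') v = tens u v + tens u' v.
Proof. by have := tens_linearl v 1 u u'; rewrite !scale1r. Qed.

Lemma tensDr u v v' : tens u (v + v') = tens u v + tens u v'.
Proof. exact: linearD. Qed.

Lemma tensZr a u v : tens u (a *: v) = a *: tens u v.
Proof. exact: linearZ. Qed.

Lemma tens0l v : tens (0 : U) v = 0.
Proof. by apply: (addrI (tens 0 v)); rewrite -tensDl !addr0. Qed.

Lemma tens0r u : tens u (0 : V) = 0.
Proof. exact: linear0. Qed.

Lemma tensZl a u v : tens (a *: u) v = a *: tens u v.
Proof. by have := tens_linearl v a u 0; rewrite !addr0 tens0l addr0. Qed.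

End TensorTheory.

Notation "u ⊗ v" := (tens u v) (at level 40, left associativity) : ring_scope.

Section TensorLift.
Context {k : fieldType} {U V W : lmodType k} (f : U -> V -> W).

Definition bilin := (forall v, linear (f^~ v)) /\ (forall u, linear (f u)).

Let f0 : {linear {malg k[(U * V)%type]} -> W} :=
  free_lift (fun uv => f uv.1 uv.2).

Lemma tensor_lift_subproof : bilin -> forall w, @tensor_rel k U V w -> f0 w = 0.
Proof.
move=> [fl fr] _ [a u u' v|a u v v']; rewrite linearB linearP /f0 /= !free_liftU /=.
  by rewrite [f _ v]fl subrr.
by rewrite fr subrr.
Qed.

Definition tensor_lift (fb : bilin) : tensor U V -> W :=
  lquot_lift (tensor_lift_subproof fb).

Fact tensor_lift_linear fb : linear (tensor_lift fb).
Proof. exact: lquot_lift_linear. Qed.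
HB.instance Definition _ fb := GRing.isLinear.Build k (tensor U V) W _
  (tensor_lift fb) (tensor_lift_linear fb).

Lemma tensor_liftE fb u v : tensor_lift fb (u ⊗ v) = f u v.
Proof.
by rewrite tens.unlock; exact: etrans (lquot_liftE _ _) (free_liftU _ _).
Qed.

End TensorLift.

Lemma tensor_ext (k : fieldType) (U V W : lmodType k)
    (f g : {linear tensor U V -> W}) :
  (forall u v, f (u ⊗ v) = g (u ⊗ v)) -> f =1 g.
Proof.
move=> fg t; rewrite (lcls_surj t).
have := @free_ext k (U * V)%type W (f \o @lcls _ _ _) (g \o @lcls _ _ _).
by apply=> -[u v]; have := fg u v; rewrite !tens.unlock.
Qed.

(** * Homology of  U --f--> V --g--> W  at V *)

Section Homology.
Context {k : fieldType} {U V W : lmodType k}.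
Context (f : {linear U -> V}) (g : {linear V -> W}).

Definition is_cycle : pred V := fun v => g v == 0.

Fact is_cycle_submod_closed : submod_closed is_cycle.
Proof.
split=> [|a u v]; first by rewrite unfold_in linear0.
by rewrite !unfold_in linearP => /eqP -> /eqP ->; rewrite scaler0 addr0.
Qed.

HB.instance Definition _ :=
  GRing.isSubmodClosed.Build k V is_cycle is_cycle_submod_closed.

Definition cycles := {v : V | is_cycle v}.
HB.instance Definition _ := SubChoice.on cycles.
HB.instance Definition _ := [SubChoice_isSubLmodule of cycles by <:].

Definition is_boundary (c : cycles) : Prop := exists u, f u = val c.

Definition homology := lquot is_boundary.
HB.instance Definition _ := GRing.Lmodule.on homology.

Definition hcls (c : V) (gc : g c = 0) : homology :=
  lcls is_boundary (exist _ c (introT eqP gc)).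

End Homology.

Section HomologyMap.
Context {k : fieldType} {U V W U' V' W' : lmodType k}.
Context (f : {linear U -> V}) (g : {linear V -> W}).
Context (f' : {linear U' -> V'}) (g' : {linear V' -> W'}).
Context (phi : {linear V -> V'}).
Hypothesis phi_cycle : forall v, g v = 0 -> g' (phi v) = 0.
Hypothesis phi_boundary : forall u, exists u', f' u' = phi (f u).

Definition cycle_map (c : cycles g) : homology f' g' :=
  hcls f' (phi_cycle (elimT eqP (valP c))).

Fact cycle_map_linear : linear cycle_map.
Proof.
move=> a c c'; rewrite -linearP; congr lcls; apply: val_inj => /=.
exact: linearP.
Qed.

HB.instance Definition _ := GRing.isLinear.Build k (cycles g)
  (homology f' g') _ cycle_map cycle_map_linear.

Fact cycle_map_boundary c : @is_boundary k U V W f g c -> cycle_map c = 0.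
Proof.
move=> [u uc]; apply: lcls_eq0; rewrite /is_boundary /=.
by have [u' e] := phi_boundary u; exists u'; rewrite e uc.
Qed.

Definition homology_map : homology f g -> homology f' g' :=
  lquot_lift cycle_map_boundary.
HB.instance Definition _ := GRing.Linear.on homology_map.

End HomologyMap.

(** * Quotient of an algebra by the two-sided ideal generated by a list *)

Section AlgebraQuotient.
Context {k : fieldType} {F : algType k} (rels : seq F).

Definition ideal_gen (f : F) : Prop :=
  exists u r v, r \in rels /\ f = u * r * v.

Definition proper_rels := ~ in_lspan ideal_gen 1.

Lemma idealMl (w f : F) : in_lspan ideal_gen f -> in_lspan ideal_gen (w * f).
Proof.
elim=> [|a g h [u [r [v [rR ->]]]] _ IH].
  by rewrite mulr0; apply: in_lspan0.
rewrite mulrDr -scalerAr; apply: in_lspanD => //.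
by exists (w * u), r, v; rewrite !mulrA.
Qed.

Lemma idealMr (w f : F) : in_lspan ideal_gen f -> in_lspan ideal_gen (f * w).
Proof.
elim=> [|a g h [u [r [v [rR ->]]]] _ IH].
  by rewrite mul0r; apply: in_lspan0.
rewrite mulrDl -scalerAl; apply: in_lspanD => //.
by exists u, r, (v * w); rewrite !mulrA.
Qed.

(* Properness is needed because an [algType] is a nonzero ring. *)
Definition alg_quot of proper_rels := lquot ideal_gen.

Context (hR : proper_rels).
Local Notation Q := (alg_quot hR).
HB.instance Definition _ := GRing.Lmodule.on Q.

Definition aq_pi (f : F) : Q := lcls ideal_gen f.
Fact aq_pi_linear : linear aq_pi. Proof. exact: lcls_linear. Qed.
HB.instance Definition _ := GRing.isLinear.Build k F Q _ aq_pi aq_pi_linear.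

Lemma aq_surj (a : Q) : a = aq_pi (repr (a : lquot ideal_gen)).
Proof. exact: lcls_surj. Qed.

Lemma aq_eq (f g : F) : aq_pi f = aq_pi g <-> in_lspan ideal_gen (f - g).
Proof. exact: lcls_eq. Qed.

Definition aq_mul (a b : Q) : Q :=
  aq_pi (repr (a : lquot ideal_gen) * repr (b : lquot ideal_gen)).

Lemma aq_mulE f g : aq_mul (aq_pi f) (aq_pi g) = aq_pi (f * g).
Proof.
rewrite /aq_mul; set f' := repr _; set g' := repr _.
have /aq_eq ff : aq_pi f' = aq_pi f by rewrite -aq_surj.
have /aq_eq gg : aq_pi g' = aq_pi g by rewrite -aq_surj.
transitivity (aq_pi (f' * g)).
  by apply/aq_eq; rewrite -mulrBr; apply: idealMl.
by apply/aq_eq; rewrite -mulrBl; apply: idealMr.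
Qed.

Fact aq_mulA : associative aq_mul.
Proof.
move=> a b c; rewrite (aq_surj a) (aq_surj b) (aq_surj c).
by rewrite !aq_mulE mulrA.
Qed.
Fact aq_mul1 : left_id (aq_pi 1) aq_mul.
Proof. by move=> a; rewrite (aq_surj a) aq_mulE mul1r. Qed.
Fact aq_1mul : right_id (aq_pi 1) aq_mul.
Proof. by move=> a; rewrite (aq_surj a) aq_mulE mulr1. Qed.
Fact aq_mulDl : left_distributive aq_mul +%R.
Proof.
move=> a b c; rewrite (aq_surj a) (aq_surj b) (aq_surj c).
by rewrite -linearD !aq_mulE mulrDl linearD.
Qed.
Fact aq_mulDr : right_distributive aq_mul +%R.
Proof.
move=> a b c; rewrite (aq_surj a) (aq_surj b) (aq_surj c).
by rewrite -linearD !aq_mulE mulrDr linearD.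
Qed.
Fact aq_1_neq0 : aq_pi 1 != 0.
Proof.
by apply/eqP; rewrite -(linear0 aq_pi) => /aq_eq; rewrite subr0 => /hR.
Qed.

HB.instance Definition _ := GRing.Zmodule_isNzRing.Build Q
  aq_mulA aq_mul1 aq_1mul aq_mulDl aq_mulDr aq_1_neq0.

Fact aq_monoid_morphism : monoid_morphism aq_pi.
Proof. by split=> [|f g]; [exact: erefl | exact: esym (aq_mulE f g)]. Qed.
HB.instance Definition _ :=
  GRing.isMonoidMorphism.Build F Q aq_pi aq_monoid_morphism.

Fact aq_scaleAl (t : k) (a b : Q) : t *: (a * b) = (t *: a) * b.
Proof.
rewrite (aq_surj a) (aq_surj b); set f := repr _; set g := repr _.
by rewrite -rmorphM -!linearZ -rmorphM scalerAl.
Qed.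
HB.instance Definition _ := GRing.Lmodule_isLalgebra.Build k Q aq_scaleAl.

Fact aq_scaleAr (t : k) (a b : Q) : t *: (a * b) = a * (t *: b).
Proof.
rewrite (aq_surj a) (aq_surj b); set f := repr _; set g := repr _.
by rewrite -rmorphM -!linearZ -rmorphM scalerAr.
Qed.
HB.instance Definition _ := GRing.Lalgebra_isAlgebra.Build k Q aq_scaleAr.

Lemma aq_rel r : r \in rels -> aq_pi r = 0.
Proof.
by move=> rR; apply: lcls_eq0; exists 1, r, 1; rewrite mul1r mulr1.
Qed.

End AlgebraQuotient.

Definition letter := 'I_3.
Definition X : letter := @Ordinal 3 0 isT.
Definition Y : letter := @Ordinal 3 1 isT.
Definition Z : letter := @Ordinal 3 2 isT.

Section Relators.
Context {k : fieldType} {F : algType k} (g : letter -> F).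

Definition relators : seq F :=
  [:: g X ^+ 2 + g Y * g X; g X * g Z; g Z * g Y].

Lemma relators_proper (aug : F -> k) :
    aug 0 = 0 -> aug 1 = 1 -> {morph aug : f h / f + h} ->
    {morph aug : f h / f * h} -> (forall a f, aug (a *: f) = a * aug f) ->
    (forall i, aug (g i) = 0) ->
  proper_rels relators.
Proof.
move=> aug0 aug1 augD augM augZ aug_g.
suff h f : in_lspan (ideal_gen relators) f -> aug f = 0.
  by move=> /h /eqP; rewrite aug1 oner_eq0.
elim=> [//|a u v [l [r [w [rR ->]]]] _ IH].
rewrite augD IH addr0 augZ !augM; suff -> : aug r = 0.
  by rewrite mulr0 mul0r mulr0.
move: rR; rewrite !inE expr2 => /or3P[] /eqP->.
- by rewrite augD !augM !aug_g mulr0 addr0.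
- by rewrite augM !aug_g mulr0.
- by rewrite augM !aug_g mulr0.
Qed.

Context (hR : proper_rels relators).
Local Notation pi := (aq_pi hR).

Lemma relators1 : (pi (g X) + pi (g Y)) * pi (g X) = 0.
Proof.
by rewrite -rmorphD -rmorphM mulrDl -expr2; apply: aq_rel; rewrite inE eqxx.
Qed.

Lemma relators2 : pi (g X) * pi (g Z) = 0.
Proof. by rewrite -rmorphM; apply: aq_rel; rewrite !inE eqxx orbT. Qed.

Lemma relators3 : pi (g Z) * pi (g Y) = 0.
Proof. by rewrite -rmorphM; apply: aq_rel; rewrite !inE eqxx !orbT. Qed.

End Relators.

(** * The reduced Hochschild complex of an algebra in degrees 0, 1 and 2 *)

Definition Abar (k : fieldType) (A : algType k) := lquot (fun a : A => a = 1).
HB.instance Definition _ k A := GRing.Lmodule.on (@Abar k A).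

HB.lock Definition bar (k : fieldType) (A : algType k) (a : A) : Abar A :=
  lcls (fun a : A => a = 1) a.
Arguments bar {k A} a.

Lemma scaler_addB3 (k : fieldType) (V : lmodType k) (t : k)
    (p p' q q' r r' : V) :
  (t *: p + p') - (t *: q + q') + (t *: r + r')
  = t *: (p - q + r) + (p' - q' + r').
Proof. by rewrite scalerDr scalerBr opprD (addrACA (t *: p)) [LHS]addrACA. Qed.

Lemma addr_comm4 (V : zmodType) (p q r s : V) :
  (p - q + r) - (r - s + p) = s - q.
Proof.
by rewrite (addrAC p) (addrAC r) (addrC r p) opprB [LHS]addrC addrA subrK.
Qed.

Section Hochschild.
Context {k : fieldType} (A : algType k).
Local Notation Abar := (Abar A).

Fact bar_linear : linear (@bar k A).
Proof. by rewrite bar.unlock; exact: lcls_linear. Qed.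
HB.instance Definition _ := GRing.isLinear.Build k A Abar _ bar bar_linear.

Lemma bar0 : bar (0 : A) = 0. Proof. exact: linear0. Qed.
Lemma bar1 : bar (1 : A) = 0.
Proof. by rewrite bar.unlock; exact: lcls_eq0. Qed.
Lemma barD : {morph @bar k A : a b / a + b}. Proof. exact: linearD. Qed.
Lemma barZ t : {morph @bar k A : a / t *: a}. Proof. exact: linearZ. Qed.

Lemma repr_bar (a : A) : exists t : k, repr (bar a) = a + t%:A.
Proof.
rewrite bar.unlock; set q := lcls _ a.
have /lcls_eq : lcls _ (repr q) = q by rewrite -lcls_surj.
suff h b : in_lspan (fun a : A => a = 1) b -> exists t : k, b = t%:A.
  by move=> /h[t e]; exists t; rewrite -e addrC subrK.
elim=> [|s _ v -> _ [t ->]]; first by exists 0; rewrite scale0r.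
by exists (s + t); rewrite scalerDl.
Qed.

Lemma bar_surj (c : Abar) : c = bar (repr c).
Proof. by rewrite bar.unlock; exact: lcls_surj. Qed.

(* b(a0 ⊗ a1) = a0 a1 - a1 a0, computed on a representative of a1. *)
Definition b1_fun (a0 : A) (c1 : Abar) : A := a0 * repr c1 - repr c1 * a0.

Lemma b1_funE a0 a1 : b1_fun a0 (bar a1) = a0 * a1 - a1 * a0.
Proof.
rewrite /b1_fun; have [t ->] := repr_bar a1.
rewrite mulrDr mulrDl -scalerAl -scalerAr mul1r mulr1.
by rewrite opprD addrACA subrr addr0.
Qed.

Lemma b1_bilin : bilin b1_fun.
Proof.
split=> [c|a] t u v.
  rewrite /b1_fun mulrDl mulrDr -scalerAl -scalerAr scalerBr.
  by rewrite opprD addrACA.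
rewrite (bar_surj u) (bar_surj v) -linearP !b1_funE.
by rewrite mulrDl mulrDr -scalerAl -scalerAr scalerBr opprD addrACA.
Qed.

Definition b1 : tensor A Abar -> A := tensor_lift b1_bilin.
HB.instance Definition _ := GRing.Linear.on b1.

Lemma b1E a0 a1 : b1 (a0 ⊗ bar a1) = a0 * a1 - a1 * a0.
Proof. by rewrite /b1 tensor_liftE b1_funE. Qed.

(* b(a0 ⊗ a1 ⊗ a2) = a0 a1 ⊗ a2 - a0 ⊗ a1 a2 + a2 a0 ⊗ a1, first for a fixed
   a2 in A, then for a representative of a class a2 in A/k1. *)
Definition b2_fun0 (a2 a0 : A) (c1 : Abar) : tensor A Abar :=
  (a0 * repr c1) ⊗ bar a2 - a0 ⊗ bar (repr c1 * a2) + (a2 * a0) ⊗ c1.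

Lemma b2_fun0E a2 a0 a1 : b2_fun0 a2 a0 (bar a1) =
  (a0 * a1) ⊗ bar a2 - a0 ⊗ bar (a1 * a2) + (a2 * a0) ⊗ bar a1.
Proof.
rewrite /b2_fun0; have [t ->] := repr_bar a1.
rewrite mulrDr mulrDl mulr_algl mulr_algr barD barZ tensDl tensDr tensZl tensZr.
by rewrite opprD addrACA subrr addr0.
Qed.

Lemma b2_fun0_bilin a2 : bilin (b2_fun0 a2).
Proof.
split=> [c|a] t u v.
  rewrite /b2_fun0 mulrDl mulrDr -scalerAl -scalerAr !tens_linearl.
  exact: scaler_addB3.
rewrite (bar_surj u) (bar_surj v) -linearP !b2_fun0E.
rewrite mulrDl mulrDr -scalerAl -scalerAr !barD !barZ !tensDr !tensZr.
by rewrite tens_linearl scaler_addB3.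
Qed.

Definition b2_fun (w : tensor A Abar) (c2 : Abar) : tensor A Abar :=
  tensor_lift (b2_fun0_bilin (repr c2)) w.

Lemma b2_funE w a2 :
  b2_fun w (bar a2) = tensor_lift (b2_fun0_bilin a2) w.
Proof.
have [t e] := repr_bar a2; rewrite /b2_fun e.
apply: tensor_ext => a0 c1 /=; rewrite (bar_surj c1) !tensor_liftE !b2_fun0E.
rewrite mulrDr mulrDl mulr_algl mulr_algr !barD !barZ bar1 scaler0 addr0.
rewrite tensDl tensDr tensZl tensZr opprD.
by rewrite [X in X + _ = _]addrA [LHS]addrACA addNr addr0.
Qed.

Lemma b2_bilin : bilin b2_fun.
Proof.
split=> [c|w] t u v; first exact: linearP.
rewrite (bar_surj u) (bar_surj v) -linearP !b2_funE.
set a := repr u; set b := repr v.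
pose g := tensor_lift (b2_fun0_bilin a); pose h := tensor_lift (b2_fun0_bilin b).
apply: (@tensor_ext _ _ _ _ _ (t \*: g \+ h)) => a0 c1.
rewrite /= /g /h !tensor_liftE (bar_surj c1) !b2_fun0E.
rewrite mulrDr mulrDl -scalerAl -scalerAr !barD !barZ !tensDr !tensZr.
by rewrite tens_linearl scaler_addB3.
Qed.

Definition b2 : tensor (tensor A Abar) Abar -> tensor A Abar :=
  tensor_lift b2_bilin.
HB.instance Definition _ := GRing.Linear.on b2.

Lemma b2E a0 a1 a2 : b2 (a0 ⊗ bar a1 ⊗ bar a2) =
  (a0 * a1) ⊗ bar a2 - a0 ⊗ bar (a1 * a2) + (a2 * a0) ⊗ bar a1.
Proof. by rewrite /b2 tensor_liftE b2_funE tensor_liftE b2_fun0E. Qed.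

(* [A,A] = im b1 is the span of the commutators. *)
Definition HH0 := lquot (fun a : A => exists u v, a = u * v - v * u).
HB.instance Definition _ := GRing.Lmodule.on HH0.

Definition HH0_cls (a : A) : HH0 := lcls _ a.
Fact HH0_cls_linear : linear HH0_cls. Proof. exact: lcls_linear. Qed.
HB.instance Definition _ := GRing.isLinear.Build k A HH0 _ HH0_cls HH0_cls_linear.

Definition HH1 := homology b2 b1.
HB.instance Definition _ := GRing.Lmodule.on HH1.

(** ** Connes' differential in degree 0 *)

Definition connes_chain (a : A) : tensor A Abar := 1 ⊗ bar a.

Lemma connes_chain_cycle a : b1 (connes_chain a) = 0.
Proof. by rewrite b1E mul1r mulr1 subrr. Qed.

Definition connes_cls (a : A) : HH1 := hcls b2 (connes_chain_cycle a).

Fact connes_cls_linear : linear connes_cls.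
Proof.
move=> t a b; rewrite -linearP; congr lcls; apply: val_inj => /=.
by rewrite /connes_chain !linearP.
Qed.

HB.instance Definition _ :=
  GRing.isLinear.Build k A HH1 _ connes_cls connes_cls_linear.

Lemma connes_cls_comm a :
  (exists u v : A, a = u * v - v * u) -> connes_cls a = 0.
Proof.
move=> [u [v ->]]; apply: lcls_eq0.
exists (1 ⊗ bar v ⊗ bar u - 1 ⊗ bar u ⊗ bar v).
rewrite linearB /= !b2E !mul1r !mulr1 addr_comm4 /connes_chain.
by rewrite linearB linearB.
Qed.

Definition connes0 : HH0 -> HH1 := lquot_lift connes_cls_comm.
HB.instance Definition _ := GRing.Linear.on connes0.

Lemma b1b2 w : b1 (b2 w) = 0.
Proof.
apply: (@tensor_ext _ _ _ _ (b1 \o b2) \0) => t c /=.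
rewrite (bar_surj c) /b2 tensor_liftE b2_funE; move: (repr c) => a2.
apply: (@tensor_ext _ _ _ _ (b1 \o tensor_lift (b2_fun0_bilin a2)) \0).
move=> a0 c1 /=; rewrite (bar_surj c1) tensor_liftE b2_fun0E.
rewrite linearD /= linearB /= !b1E !mulrA opprB [X in X + _]addrC !addrA.
by rewrite !subrK subrr.
Qed.

End Hochschild.

(** * The Koszul complex A ⊗ V2 --d2--> A ⊗ V1 --d1--> A *)

Section Koszul.
Context {k : fieldType} {A : algType k} (ltr : letter -> A).
Local Notation x := (ltr X).
Local Notation y := (ltr Y).
Local Notation z := (ltr Z).

Definition V1 := {malg k[letter]}.
HB.instance Definition _ := GRing.Lmodule.on V1.
Definition V1_basis (i : letter) : V1 := << i >>.
Definition V1_incl : V1 -> A := free_lift ltr.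
HB.instance Definition _ := GRing.Linear.on V1_incl.

(* The basis vectors 0, 1, 2 of V2 are (x+y)x, xz and zy. *)
Definition V2 := {malg k['I_3]}.
HB.instance Definition _ := GRing.Lmodule.on V2.

Definition d1_fun (a : A) (v : V1) : A := a * V1_incl v - V1_incl v * a.

Lemma d1_bilin : bilin d1_fun.
Proof.
split=> [v|a] t u w; rewrite /d1_fun.
  rewrite mulrDl mulrDr -scalerAl -scalerAr scalerBr.
  by rewrite opprD addrACA.
by rewrite linearP mulrDl mulrDr -scalerAl -scalerAr scalerBr opprD addrACA.
Qed.

Definition d1 : tensor A V1 -> A := tensor_lift d1_bilin.
HB.instance Definition _ := GRing.Linear.on d1.

Lemma d1E a i : d1 (a ⊗ V1_basis i) = a * ltr i - ltr i * a.
Proof. by rewrite /d1 tensor_liftE /d1_fun /V1_incl free_liftU. Qed.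

Definition d2_basis (a : A) (r : 'I_3) : tensor A V1 :=
  nth 0
    [:: (a * (x + y)) ⊗ V1_basis X + (x * a) ⊗ V1_basis X
          + (x * a) ⊗ V1_basis Y;
        (a * x) ⊗ V1_basis Z + (z * a) ⊗ V1_basis X;
        (a * z) ⊗ V1_basis Y + (y * a) ⊗ V1_basis Z] r.

Definition d2_fun (a : A) (w : V2) : tensor A V1 := free_lift (d2_basis a) w.

Lemma d2_basis_linear r : linear (d2_basis^~ r).
Proof.
move=> t a b; case: r => -[|[|[|j]]] // hj; rewrite /d2_basis /=;
  rewrite !mulrDl !(mulrDr _ (_ *: _)) -!scalerAl -!scalerAr !tens_linearl.
- by rewrite !scalerDr (addrACA (t *: _)) [LHS]addrACA.
- by rewrite !scalerDr [LHS]addrACA.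
- by rewrite !scalerDr [LHS]addrACA.
Qed.

Lemma d2_bilin : bilin d2_fun.
Proof.
split=> [w|a] t u v; last exact: linearP.
rewrite /d2_fun /free_lift scaler_sumr -big_split /=.
apply: eq_bigr => r _; rewrite d2_basis_linear scalerDr !scalerA.
by rewrite (mulrC t).
Qed.

Definition d2 : tensor A V2 -> tensor A V1 := tensor_lift d2_bilin.
HB.instance Definition _ := GRing.Linear.on d2.

Lemma d2E a (r : 'I_3) : d2 (a ⊗ (<< r >> : V2)) = d2_basis a r.
Proof. by rewrite /d2 tensor_liftE /d2_fun free_liftU. Qed.

Definition HH1_koszul := homology d2 d1.
HB.instance Definition _ := GRing.Lmodule.on HH1_koszul.

(** ** The comparison map, induced by  a ⊗ v |-> a ⊗ bar v *)

Lemma koszul_incl_bilin : bilin (fun (a : A) (v : V1) => a ⊗ bar (V1_incl v)).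
Proof.
split=> [v|a] t u w; first exact: tens_linearl.
by rewrite linearP barD barZ tensDr tensZr.
Qed.

Definition koszul_incl : tensor A V1 -> tensor A (Abar A) :=
  tensor_lift koszul_incl_bilin.
HB.instance Definition _ := GRing.Linear.on koszul_incl.

Lemma koszul_inclE a i : koszul_incl (a ⊗ V1_basis i) = a ⊗ bar (ltr i).
Proof. by rewrite /koszul_incl tensor_liftE /V1_incl free_liftU. Qed.

Lemma koszul_inclD : {morph koszul_incl : u v / u + v}.
Proof. exact: linearD. Qed.

Lemma b1_koszul_incl w : b1 (koszul_incl w) = d1 w.
Proof.
suff e : d1 =1 @b1 k A \o koszul_incl by rewrite e.
apply: tensor_ext => a v /=.
by rewrite /d1 /koszul_incl !tensor_liftE /b1 tensor_liftE b1_funE.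
Qed.

Lemma koszul_incl_cycle w : d1 w = 0 -> b1 (koszul_incl w) = 0.
Proof. by rewrite b1_koszul_incl. Qed.

Definition koszul_lift_basis (a : A) (r : 'I_3) :
    tensor (tensor A (Abar A)) (Abar A) :=
  nth 0 [:: a ⊗ bar (x + y) ⊗ bar x; a ⊗ bar x ⊗ bar z; a ⊗ bar z ⊗ bar y] r.

Lemma koszul_lift_basis_linear r : linear (koszul_lift_basis^~ r).
Proof.
by move=> t a b; case: r => -[|[|[|j]]] // hj; rewrite /koszul_lift_basis /=
  !tens_linearl.
Qed.

Lemma koszul_lift_bilin :
  bilin (fun (a : A) (w : V2) => free_lift (koszul_lift_basis a) w).
Proof.
split=> [w|a] t u v; last exact: linearP.
rewrite /free_lift scaler_sumr -big_split /=.
apply: eq_bigr => r _; rewrite koszul_lift_basis_linear scalerDr !scalerA.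
by rewrite (mulrC t).
Qed.

Hypothesis rel1 : (x + y) * x = 0.
Hypothesis rel2 : x * z = 0.
Hypothesis rel3 : z * y = 0.

Lemma koszul_incl_boundary (w : tensor A V2) :
  exists w', b2 w' = koszul_incl (d2 w).
Proof.
exists (tensor_lift koszul_lift_bilin w).
suff e : @b2 k A \o tensor_lift koszul_lift_bilin =1 koszul_incl \o d2.
  exact: e.
apply: tensor_ext => a v /=; rewrite /d2 !tensor_liftE /d2_fun.
suff e : @b2 k A \o free_lift (koszul_lift_basis a)
           =1 koszul_incl \o free_lift (d2_basis a) by exact: e.
apply: free_ext => r /=; rewrite !free_liftU.
case: r => -[|[|[|j]]] // hj; rewrite /koszul_lift_basis /d2_basis [LHS]/= b2E.
- by rewrite rel1 bar0 tens0r subr0 /= !koszul_inclD !koszul_inclE barD tensDr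
             addrA.
- by rewrite rel2 bar0 tens0r subr0 /= koszul_inclD !koszul_inclE.
- by rewrite rel3 bar0 tens0r subr0 /= koszul_inclD !koszul_inclE.
Qed.

Lemma d1d2 w : d1 (d2 w) = 0.
Proof.
by have [w' e] := koszul_incl_boundary w; rewrite -b1_koszul_incl -e b1b2.
Qed.

Definition koszul_to_HH1 : HH1_koszul -> HH1 A :=
  homology_map koszul_incl_cycle koszul_incl_boundary.
HB.instance Definition _ := GRing.Linear.on koszul_to_HH1.

(** ** The elements of HH_0(A) and HH_1(A) *)

Definition word (w : seq letter) : A := \prod_(i <- w) ltr i.

Definition zeta0 : HH0 A := HH0_cls 1.
Definition alpha0 (n : nat) : HH0 A := HH0_cls (x ^+ n).
Definition beta0 (n : nat) : HH0 A := HH0_cls (y ^+ n).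
Definition gamma0 (n : nat) : HH0 A := HH0_cls (z ^+ n).

Definition eps_word (p : nat) (n m : 'I_p -> nat) : seq letter :=
  flatten [seq X :: nseq (n i) Y ++ nseq (m i) Z | i <- enum 'I_p].

Definition eps0 (p : nat) (n m : 'I_p -> nat) : HH0 A :=
  HH0_cls (word (eps_word n m)).

Lemma power_cycle i n : d1 (ltr i ^+ n.-1 ⊗ V1_basis i) = 0.
Proof. by rewrite d1E -exprS -exprSr subrr. Qed.

Definition alpha1 (n : nat) : HH1_koszul := hcls d2 (power_cycle X n).
Definition beta1 (n : nat) : HH1_koszul := hcls d2 (power_cycle Y n).
Definition gamma1 (n : nat) : HH1_koszul := hcls d2 (power_cycle Z n).

(* The i-th summand is the one with v the i-th letter of s = uvw. *)
Definition theta_chain (s : seq letter) : tensor A V1 :=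
  \sum_(i < size s)
    word (drop i.+1 s ++ take i s) ⊗ V1_basis (tnth (in_tuple s) i).

Lemma theta_cycle s : d1 (theta_chain s) = 0.
Proof.
pose c i := word (drop i s ++ take i s).
have word_cat u v : word (u ++ v) = word u * word v by rewrite /word big_cat.
have word1 i : word [:: i] = ltr i by rewrite /word big_seq1.
transitivity (\sum_(0 <= i < size s) (c i.+1 - c i)).
  rewrite linear_sum big_mkord; apply: eq_bigr => i _ /=.
  have sz : (i < size s)%N by [].
  rewrite d1E (tnth_nth X) /= -word1 -!word_cat /c.
  by rewrite (take_nth X sz) (drop_nth X sz) -cats1 !catA.
by rewrite telescope_sumr // /c drop_size take_size drop0 take0 cats0 subrr.
Qed.

Definition theta1 (p : nat) (n m : 'I_p -> nat) : HH1_koszul :=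
  hcls d2 (theta_cycle (eps_word n m)).

End Koszul.

(** * The algebra A = k<x,y,z>/(x^2 + yx, xz, zy) *)

Lemma malg_scaleAr (k : fieldType) (K : monomType) (a : k)
  (f g : {malg k[K]}) : a *: (f * g) = f * (a *: g).
Proof.
rewrite -(mul_malgC a g) mulrA -(mul_malgC a) mulrA; congr (_ * g).
rewrite !malgM_def fgmulUg fgmulgU; apply: eq_bigr => m _.
by rewrite mulrC mul1m mulm1.
Qed.

Section TheAlgebra.
Context (k : fieldType).

Definition freeA := {malg k[{fmonom letter}]}.
HB.instance Definition _ := GRing.Lalgebra.on freeA.
HB.instance Definition _ :=
  GRing.Lalgebra_isAlgebra.Build k freeA (@malg_scaleAr k {fmonom letter}).

Definition gen (i : letter) : freeA := << fmu i >>.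

Fact freeA_proper : proper_rels (relators gen).
Proof.
apply: (@relators_proper k freeA gen
          (@mcoeff {fmonom letter} k (fmone letter))).
- exact: mcoeff0.
- exact: rmorph1.
- exact: mcoeffD.
- exact: rmorphM.
- by move=> a f; exact: mcoeffZ.
move=> i; rewrite /gen mcoeffU1.
by case: eqP => // /(congr1 (@fdeg _)); rewrite fdegU fdeg1.
Qed.

Definition A := alg_quot freeA_proper.
HB.instance Definition _ := GRing.Algebra.on A.

Definition xyz (i : letter) : A := aq_pi freeA_proper (gen i).

Definition koszul_to_bar : HH1_koszul xyz -> HH1 A :=
  @koszul_to_HH1 k A xyz (relators1 freeA_proper) (relators2 freeA_proper)
    (relators3 freeA_proper).
HB.instance Definition _ := GRing.Linear.on koszul_to_bar.

End TheAlgebra.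

(* Main.v *)
(** The chain [letter_chain a s], the sum of (v a u) ⊗ i over all factorizations
    s = u i v with i a letter, is homologous to a ⊗ s in the Hochschild complex.
    Hence the comparison map from the Koszul complex is onto on HH_1, and
    1 ⊗ s represents the class of theta_chain s, which gives the values of B_0.
    The comparison map is also injective: sending a ⊗ s to [letter_chain a s]
    satisfies a Leibniz rule on the free algebra, so it kills the ideal of
    relations modulo im d_2, and it defines a map from A ⊗ Abar to
    (A ⊗ V_1)/im d_2 that vanishes on boundaries and retracts the inclusion.
    The listed values determine B_0 because the listed elements span HH_0(A):
    the relations imply y^b x = ± x^(b+1) and z x x = 0, so up to sign and
    rotation every nonzero word is a power of a letter or a product of blocks
    x y^n z^m. *)

From HB Require Import structures.
Require Import Defs.
From mathcomp Require Import all_boot all_order all_algebra.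
From mathcomp Require Import boolp finmap monalg zify.

Set Implicit Arguments.
Unset Strict Implicit.
Unset Printing Implicit Defensive.

Import GRing.Theory.
Local Open Scope ring_scope.

(** * Letter chains and their homology classes *)

Section LetterChain.
Context {k : fieldType} {A : algType k} (ltr : letter -> A).

(* The sum of (v a u) ⊗ i over all factorizations s = u i v with i a letter. *)
Fixpoint letter_chain (a : A) (s : seq letter) : tensor A (V1 (k := k)) :=
  if s is i :: s' then
    (word ltr s' * a) ⊗ V1_basis i + letter_chain (a * ltr i) s'
  else 0.

Lemma word_cat s t : word ltr (s ++ t) = word ltr s * word ltr t.
Proof. by rewrite /word big_cat. Qed.

Lemma word_nil : word ltr [::] = 1.
Proof. by rewrite /word big_nil. Qed.

Lemma word_cons i s : word ltr (i :: s) = ltr i * word ltr s.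
Proof. by rewrite /word big_cons. Qed.

Lemma word_nseq n i : word ltr (nseq n i) = ltr i ^+ n.
Proof. by rewrite /word big_nseq iter_mulr mulr1. Qed.

Lemma letter_chain_linear s : linear (letter_chain^~ s).
Proof.
elim: s => [|i s IH] t a b /=; first by rewrite scaler0 addr0.
by rewrite mulrDl mulrDr -scalerAl -scalerAr tens_linearl IH scalerDr addrACA.
Qed.

Lemma letter_chain_cat a s t :
  letter_chain a (s ++ t) =
  letter_chain (word ltr t * a) s + letter_chain (a * word ltr s) t.
Proof.
elim: s a => [|i s IH] a /=; first by rewrite word_nil mulr1 add0r.
by rewrite IH word_cat word_cons !mulrA addrA.
Qed.

Lemma letter_chain_theta s : letter_chain 1 s = theta_chain ltr s.
Proof.
(* The coefficient records the letters already passed, so the induction runs over an arbitrary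
   prefix [u]; the claim is the case of empty [u]. *)
suff h u : letter_chain (word ltr u) s = \sum_(i < size s)
    word ltr (drop i.+1 s ++ u ++ take i s) ⊗ V1_basis (tnth (in_tuple s) i).
  by rewrite -word_nil h.
elim: s u => [|i s IH] u /=; first by rewrite big_ord0.
rewrite big_ord_recl /= drop0 cats0 word_cat; congr (_ + _).
have := IH (u ++ [:: i]); rewrite word_cat word_cons word_nil mulr1 => ->.
by apply: eq_bigr => j _; rewrite -catA !(tnth_nth X).
Qed.

(** Letters are peeled off from the left: $b(a ⊗ i ⊗ s') = ai ⊗ s' - a ⊗ is' + s'a ⊗ i$, so each
    letter costs one boundary and leaves the summand $s'a ⊗ i$. *)
Lemma letter_chain_bar a s :
  exists w, a ⊗ bar (word ltr s) = koszul_incl ltr (letter_chain a s) + b2 w.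
Proof.
elim: s a => [|i s IH] a /=.
  by exists 0; rewrite word_nil bar1 tens0r !linear0 addr0.
have [w e] := IH (a * ltr i).
exists (w - a ⊗ bar (ltr i) ⊗ bar (word ltr s)).
have b2B u u' : b2 (u - u') = b2 u - b2 u' :> tensor A (Abar A).
  exact: linearB.
rewrite koszul_inclD koszul_inclE b2B b2E e word_cons.
set p := _ ⊗ _; set q := _ ⊗ _; set r := koszul_incl _ _.
apply: (addIr (r + b2 w - p + q)); rewrite -[RHS]addrA subrK addrA.
by rewrite [p + _]addrC subrK addrAC [r + q]addrC.
Qed.
End LetterChain.

(** * Induction by linearity *)

Section Induction.
Context {k : fieldType}.

Lemma malg_ind (K : choiceType) (P : {malg k[K]} -> Prop) :
  P 0 -> (forall c f g, P f -> P g -> P (c *: f + g)) ->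
  (forall i, P << i >>) -> forall f, P f.
Proof.
move=> P0 PD PU f; rewrite (monalgE f); elim/big_ind: _ => // [g h Pg Ph|i _].
  by rewrite -[g]scale1r; exact: PD.
have -> : << f@_i *g i >> = f@_i *: << i >> + 0 :> {malg k[K]}.
  by apply/malgP => j; rewrite addr0 mcoeffZ !mcoeffU mulr_natr.
exact: PD.
Qed.

Lemma tensor_ind (U V : lmodType k) (P : tensor U V -> Prop) :
  P 0 -> (forall c t t', P t -> P t' -> P (c *: t + t')) ->
  (forall u v, P (u ⊗ v)) -> forall t, P t.
Proof.
move=> P0 PD PT t; rewrite (lcls_surj t); move: (repr _).
apply: malg_ind => [|c f g|[u v]]; rewrite ?linear0 ?linearP //.
  exact: PD.
by have := PT u v; rewrite tens.unlock.
Qed.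

End Induction.

(** * Reduction of bar chains to Koszul chains modulo boundaries *)

Section WordSpan.
Context {k : fieldType} {A : algType k} (ltr : letter -> A).

Hypothesis words_span : forall P : A -> Prop, P 0 ->
  (forall c a b, P a -> P b -> P (c *: a + b)) -> (forall s, P (word ltr s)) ->
  forall a, P a.

(** For a pure tensor whose second factor is a word this is [letter_chain_bar]; such decompositions
    are stable under linear combinations, and words span. *)
Lemma koszul_incl_bar_decomp t : exists w u, t = koszul_incl ltr w + b2 u.
Proof.
have PD c t1 t2 : (exists w u, t1 = koszul_incl ltr w + b2 u) ->
    (exists w u, t2 = koszul_incl ltr w + b2 u) ->
    exists w u, c *: t1 + t2 = koszul_incl ltr w + b2 u.
  move=> [w [u ->]] [w' [u' ->]]; exists (c *: w + w'), (c *: u + u').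
  have incl_lin := linearP (koszul_incl ltr).
  have b2_lin := linearP (@b2 k A).
  by rewrite incl_lin b2_lin scalerDr addrACA.
have P0 : exists w u, 0 = koszul_incl ltr w + b2 u.
  by exists 0, 0; rewrite !linear0 addr0.
apply: (tensor_ind P0 PD) t => a c; rewrite (bar_surj c); move: (repr c) => b.
pose P b := exists w u, a ⊗ bar b = koszul_incl ltr w + b2 u.
apply: (words_span (P := P)) b => [|e b b' Pb Pb'|s]; rewrite /P.
- by rewrite bar0 tens0r.
- by rewrite linearP /= linearP; apply: PD.
have [w e] := letter_chain_bar ltr a s.
by exists (letter_chain ltr a s), w.
Qed.

End WordSpan.

(** * The derivation on the free algebra and the retraction onto coker $d_2$ *)

Lemma mulPl (k : fieldType) (B : algType k) (c : k) (p q r : B) :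
  (c *: p + q) * r = c *: (p * r) + q * r.
Proof. by rewrite mulrDl scalerAl. Qed.

Lemma mulPr (k : fieldType) (B : algType k) (c : k) (p q r : B) :
  r * (c *: p + q) = c *: (r * p) + r * q.
Proof. by rewrite mulrDr scalerAr. Qed.

Lemma addr_shuffle (V : nmodType) (p q r t : V) :
  p + q + r + t = r + p + (t + q).
Proof. by rewrite (ACl (3 * 1 * (4 * 2))%AC). Qed.

(** With the varying factor last, $u \mapsto u ⊗ v$ can carry a linear structure and be composed in
    [tensor_ext]. *)
Definition tens_r (k : fieldType) (U V : lmodType k) (v : V) (u : U) := u ⊗ v.

HB.instance Definition _ (k : fieldType) (U V : lmodType k) (v : V) :=
  GRing.isLinear.Build k U (tensor U V) _ (@tens_r k U V v) (tens_linearl v).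

Section Presentation.
Context {k : fieldType} {A : algType k}.
Context (pi : {lrmorphism freeA k -> A}) (lift : A -> freeA k).
Hypothesis liftK : cancel lift pi.
Hypothesis pi_ker : forall f,
  pi f = 0 <-> in_lspan (ideal_gen (relators (@gen k))) f.

Let v i := pi (gen k i).

Lemma monomial_cat (m n : {fmonom letter}) :
  << (fmmul m n) >> = << m >> * << n >> :> freeA k.
Proof. by rewrite [RHS]fgmulUU mulr1. Qed.

Lemma pi_monomial (m : {fmonom letter}) : pi << m >> = word v m.
Proof.
case: m => s; elim: s => [|i s IH] /=.
  rewrite word_nil -(rmorph1 pi); congr (pi << _ >>).
  by apply: val_inj; rewrite /= fm1.
rewrite word_cons -IH -rmorphM; congr (pi _).
rewrite /gen -monomial_cat; congr << _ >>.
by apply: val_inj; rewrite /= fmM fmU.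
Qed.

Lemma words_span (P : A -> Prop) : P 0 ->
  (forall c a b, P a -> P b -> P (c *: a + b)) -> (forall s, P (word v s)) ->
  forall a, P a.
Proof.
move=> P0 PD PW a; rewrite -(liftK a); move: (lift a).
apply: malg_ind => [|c f g Pf Pg|m]; first by rewrite linear0.
  by rewrite linearP; exact: PD.
by rewrite pi_monomial.
Qed.

Local Notation coker_d2 := (lquot (fun t => exists u, d2 v u = t)).
Local Notation cls := (lcls (fun t => exists u, d2 v u = t)).

(** A cyclic form of the universal derivation of the free algebra. Values are taken modulo im $d_2$,
    where the relators are killed. *)
Definition diff (a : A) : freeA k -> coker_d2 :=
  free_lift (fun m : {fmonom letter} => cls (letter_chain v a m)).
HB.instance Definition _ a := GRing.Linear.on (diff a).

Lemma diffU a (m : {fmonom letter}) : diff a << m >> = cls (letter_chain v a m).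
Proof. exact: free_liftU. Qed.

Lemma diff0 a : diff a 0 = 0. Proof. exact: linear0. Qed.

Lemma diffP a c f g : diff a (c *: f + g) = c *: diff a f + diff a g.
Proof. exact: linearP. Qed.

Lemma diff_linear f : linear (diff^~ f).
Proof.
move=> t a b; move: f; apply: malg_ind => [|c f g IHf IHg|m].
- by rewrite !diff0 scaler0 addr0.
- rewrite !diffP IHf IHg !scalerDr !scalerA [t * c]mulrC; exact: addrACA.
- rewrite !diffU letter_chain_linear; exact: linearP.
Qed.

Lemma diff0l f : diff 0 f = 0.
Proof.
by have := diff_linear f (-1) 0 0; rewrite scaler0 addr0 scaleN1r addNr.
Qed.

Lemma pi_lin c f g : pi (c *: f + g) = c *: pi f + pi g.
Proof. exact: linearP. Qed.

(** The Leibniz rule. Both sides are linear in [f] and in [g], and on monomials the rule is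
    [letter_chain_cat]. *)
Lemma diffM a f g : diff a (f * g) = diff (pi g * a) f + diff (a * pi f) g.
Proof.
move: f; apply: malg_ind => [|c f f' IH IH'|m].
- by rewrite mul0r !diff0 rmorph0 mulr0 diff0l addr0.
- rewrite (@mulPl k (freeA k)).
  apply: etrans (diffP a c (f * g) (f' * g)) _.
  apply: etrans (congr2 (fun p q => c *: p + q) IH IH') _.
  rewrite (diffP (pi g * a)) (pi_lin c f f') (@mulPr k A c (pi f) (pi f') a).
  by rewrite diff_linear scalerDr; exact: addrACA.
move: g; apply: malg_ind => [|c f f' IH IH'|n].
- by rewrite mulr0 !diff0 rmorph0 mul0r diff0l addr0.
- rewrite (@mulPr k (freeA k)); set m' := << m >> in IH IH' *.
  apply: etrans (diffP a c (m' * f) (m' * f')) _.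
  apply: etrans (congr2 (fun p q => c *: p + q) IH IH') _.
  rewrite (diffP (a * pi m')) (pi_lin c f f') (@mulPl k A c (pi f) (pi f') a).
  by rewrite diff_linear scalerDr; exact: addrACA.
rewrite -monomial_cat !diffU !pi_monomial fmM letter_chain_cat; exact: linearD.
Qed.

Lemma diff1 a : diff a 1 = 0.
Proof. rewrite [1]/(<< fmone _ >>) diffU fm1 /=; exact: linear0. Qed.

Lemma diff_gen a i : diff a (gen k i) = cls (a ⊗ V1_basis i).
Proof. by rewrite /gen diffU fmU /= word_nil mul1r addr0. Qed.

Lemma diffD a f g : diff a (f + g) = diff a f + diff a g.
Proof. exact: linearD. Qed.

Lemma diff_genM a i j : diff a (gen k i * gen k j) =
  cls ((v j * a) ⊗ V1_basis i + (a * v i) ⊗ V1_basis j).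
Proof. by rewrite diffM !diff_gen lclsD. Qed.

(** Before passing to the quotient, the derivative of a relator is $d_2(a ⊗ r)$, with $r$ the
    corresponding basis vector of $V_2$. *)
Lemma diff_rel a r : r \in relators (@gen k) -> diff a r = 0.
Proof.
rewrite !inE => /or3P[] /eqP ->.
- rewrite expr2; apply: etrans (diffD a _ _) _.
  apply: etrans (congr2 +%R (diff_genM a X X) (diff_genM a Y X)) _.
  rewrite -lclsD; apply: lcls_eq0.
  exists (a ⊗ << ord0 >>); rewrite d2E /d2_basis /= mulrDr tensDl.
  exact: addr_shuffle.
- rewrite diff_genM; apply: lcls_eq0.
  exists (a ⊗ << Ordinal (isT : 1 < 3)%N >>).
  by rewrite d2E /d2_basis /= addrC.
- rewrite diff_genM; apply: lcls_eq0.
  exists (a ⊗ << Ordinal (isT : 2 < 3)%N >>).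
  by rewrite d2E /d2_basis /= addrC.
Qed.

(** Two uses of the Leibniz rule split the derivative of $urw$ into three terms: one differentiates
    the relator $r$, the other two have a coefficient containing [pi r], which is zero. *)
Lemma diff_ker a f : pi f = 0 -> diff a f = 0.
Proof.
move=> /pi_ker; elim=> [|c _ g [u [r [w [rR ->]]]] _ IH]; first exact: diff0.
have r0 : pi r = 0.
  apply/pi_ker; rewrite -[r]addr0 -[r]scale1r; constructor; last by constructor.
  by exists 1, r, 1; rewrite mul1r mulr1.
have ur0 : pi (u * r) = 0 by rewrite rmorphM /= r0 mulr0.
rewrite diffP IH addr0 diffM diffM (diff_rel _ rR) ur0 mulr0 r0 mul0r.
by rewrite !diff0l !addr0 scaler0.
Qed.

Lemma diff_pi a f g : pi f = pi g -> diff a f = diff a g.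
Proof.
move=> e; apply/eqP; rewrite -subr_eq0; apply/eqP.
have <- : diff a (f - g) = diff a f - diff a g by exact: linearB.
by apply: diff_ker; rewrite linearB /= e subrr.
Qed.

(* The retraction onto coker d_2 of the inclusion of A ⊗ V_1. *)
Definition psi_fun (a : A) (c : Abar A) : coker_d2 := diff a (lift (repr c)).

(** Independence of both choices: the representative of the class modulo scalars changes [f] by a
    multiple of 1, killed by [diff1], and the lift matters only modulo the kernel of [pi]. *)
Lemma psi_funE a f : psi_fun a (bar (pi f)) = diff a f.
Proof.
rewrite /psi_fun; have [t ->] := repr_bar (pi f).
have -> : diff a (lift (pi f + t%:A)) = diff a (t *: 1 + f).
  by apply: diff_pi; rewrite liftK pi_lin rmorph1 addrC.
by rewrite diffP diff1 scaler0 add0r.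
Qed.

Lemma psi_bilin : bilin psi_fun.
Proof.
split=> [c|a] t u w; first exact: diff_linear.
rewrite (bar_surj u) (bar_surj w) -linearP /=.
rewrite -[repr u]liftK -[repr w]liftK -pi_lin !psi_funE; exact: diffP.
Qed.

Definition psi : tensor A (Abar A) -> coker_d2 := tensor_lift psi_bilin.
HB.instance Definition _ := GRing.Linear.on psi.

Lemma psiE a f : psi (a ⊗ bar (pi f)) = diff a f.
Proof. by rewrite /psi tensor_liftE psi_funE. Qed.

(** The three terms of $b$ are sent to the three terms of the Leibniz rule. *)
Lemma psi_b2_pure a f g : psi (b2 (a ⊗ bar (pi f) ⊗ bar (pi g))) = 0.
Proof.
have psi3 p q r : psi (p - q + r) = psi p - psi q + psi r.
  by apply: etrans (linearD _ _ _) _; congr (_ + _); exact: linearB.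
rewrite b2E -rmorphM; apply: etrans (psi3 _ _ _) _.
by rewrite !psiE diffM [X in _ - X]addrC opprD addrA subrr sub0r addNr.
Qed.

Lemma psi_b2 w : psi (b2 w) = 0.
Proof.
suff e : psi \o @b2 k A =1 \0 by exact: e.
apply: tensor_ext => t c; rewrite (bar_surj c) -[repr c]liftK.
suff e :
    psi \o @b2 k A \o @tens_r _ _ (Abar A) (bar (pi (lift (repr c)))) =1 \0.
  by exact: e.
apply: tensor_ext => a c1; rewrite (bar_surj c1) -[repr c1]liftK.
exact: psi_b2_pure.
Qed.

Lemma psi_koszul_incl w : psi (koszul_incl v w) = cls w.
Proof.
suff e : psi \o koszul_incl v =1 cls by exact: e.
apply: tensor_ext => a u.
suff e : psi \o koszul_incl v \o tens a =1 cls \o tens a by exact: e.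
by apply: free_ext => i /=; rewrite (koszul_inclE v a i) psiE diff_gen.
Qed.

(** Applying [psi] to the equation gives [cls w = 0], and the image of $d_2$ is already closed under
    linear combinations. *)
Lemma koszul_incl_boundary_inv w u :
  koszul_incl v w = b2 u -> exists u', d2 v u' = w.
Proof.
move=> e; have := psi_koszul_incl w; rewrite e psi_b2 => /esym.
rewrite -[0 in RHS](linear0 cls) => /lcls_eq; rewrite subr0.
elim=> [|c _ g [u1 <-] _ [u2 <-]]; first by exists 0; exact: linear0.
by exists (c *: u1 + u2); exact: linearP.
Qed.

End Presentation.

(** * Normal forms of words, and traces determined by their values on the listed elements *)

Section Traces.
Context {k : fieldType} {A : algType k} (ltr : letter -> A).
Local Notation x := (ltr X).
Local Notation y := (ltr Y).
Local Notation z := (ltr Z).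
Hypothesis rel1 : (x + y) * x = 0.
Hypothesis rel2 : x * z = 0.
Hypothesis rel3 : z * y = 0.

Lemma relyx : y * x = - (x * x).
Proof. by apply/eqP; rewrite -addr_eq0 addrC -mulrDl rel1. Qed.

Lemma relyXx b : y ^+ b * x = (-1) ^+ b *: x ^+ b.+1.
Proof.
elim: b => [|b IH]; first by rewrite !expr0 mul1r scale1r expr1.
rewrite exprS -mulrA IH -scalerAr [x ^+ b.+1]exprS mulrA relyx.
by rewrite mulNr -mulrA -!exprS scalerN [(-1) ^+ b.+1]exprS mulN1r scaleNr.
Qed.

(** The product $zyx$ is 0 because $zy = 0$, and it equals $-zxx$ because $yx = -xx$. *)
Lemma relzxx : z * x * x = 0.
Proof.
have : z * (y * x) = 0 by rewrite mulrA rel3 mul0r.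
by rewrite relyx mulrN mulrA => /eqP; rewrite oppr_eq0 => /eqP.
Qed.

(** Blocks are kept in lists so that words can grow at the right end; [pairs_word_eps_word]
    translates to the indexed families of [eps_word]. *)
Definition pair_word (q : nat * nat) := X :: nseq q.1 Y ++ nseq q.2 Z.

Definition pairs_word (l : seq (nat * nat)) := flatten (map pair_word l).

Definition positive_pairs (l : seq (nat * nat)) :=
  all (fun q => (0 < q.1)%N && (0 < q.2)%N) l.

(* Up to scalars, the reductions of the words that start with x. *)
Inductive xform : A -> Prop :=
  | xform_xy a b : xform (x ^+ a.+1 * y ^+ b)
  | xform_pairs a l b c of positive_pairs l :
      xform (x ^+ a * word ltr (pairs_word (rcons l (b.+1, c.+1))))
  | xform_pairs_xy a l q b of positive_pairs (rcons l q) :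
      xform (x ^+ a * word ltr (pairs_word (rcons l q)) * x * y ^+ b).

Lemma word_pairs_rcons l q :
  word ltr (pairs_word (rcons l q)) =
  word ltr (pairs_word l) * x * y ^+ q.1 * z ^+ q.2.
Proof.
rewrite /pairs_word map_rcons -cats1 flatten_cat word_cat /= cats0 word_cons.
by rewrite word_cat !word_nseq !mulrA.
Qed.

Lemma pairs_last_xx l q u : (0 < q.2)%N ->
  word ltr (pairs_word (rcons l q)) * (x * (x * u)) = 0.
Proof.
case: q => b [] //= c _; rewrite word_pairs_rcons /= [z ^+ c.+1]exprSr.
rewrite -!mulrA [x * (x * u)]mulrA [z * (x * x * u)]mulrA [z * (x * x)]mulrA.
by rewrite relzxx mul0r !mulr0.
Qed.

Lemma pairs_word_xz l q : (0 < q.2)%N ->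
  exists u, word ltr (pairs_word (rcons l q)) = x * (u * z).
Proof.
case: q => b [] //= c _; rewrite word_pairs_rcons /= [z ^+ c.+1]exprSr.
suff [u ->] : exists u, word ltr (pairs_word l) * x = x * u.
  by exists (u * y ^+ b * z ^+ c); rewrite !mulrA.
case: l => [|q l]; first by exists 1; rewrite word_nil mul1r mulr1.
by rewrite word_cons; eexists; rewrite -mulrA.
Qed.

(** Three forms times three letters. A new letter extends the form, is absorbed through $y^b x = ±
    x^{b+1}$, or gives zero through $xz$, $zy$ or $zxx$. *)
Lemma xform_rcons u i : xform u -> exists c w, u * ltr i = c *: w /\ xform w.
Proof.
have done0 v : v = 0 -> exists c w, v = c *: w /\ xform w.
  (* A vanishing product gets the scalar 0; the form $x$ is a placeholder. *)
  move=> ->; exists 0, (x ^+ 1 * y ^+ 0); rewrite scale0r.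
  by split => //; apply: xform_xy.
have done1 v : xform v -> exists c w, v = c *: w /\ xform w.
  by move=> hv; exists 1, v; rewrite scale1r.
have caseI : [\/ i = X, i = Y | i = Z].
  case: i => -[|[|[|//]]] hi; [apply: Or31|apply: Or32|apply: Or33];
    exact: val_inj.
case=> [a b|a l b c hl|a l q b hl]; case: caseI => ->.
- rewrite -mulrA relyXx -scalerAr -exprD -[x ^+ _]mulr1 -(expr0 y) addSn.
  by eexists _, _; split; [reflexivity | apply: xform_xy].
- by apply: done1; rewrite -mulrA -exprSr; apply: xform_xy.
- case: b => [|b].
    by apply: done0; rewrite mulr1 exprSr -mulrA rel2 mulr0.
  (* The last $x$ of $x^{a+1}$ opens the first block $x y^{b+1} z$; the arguments [b] and [0] stand
     for the exponents $b+1$ and 1. *)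
  apply: done1; have := @xform_pairs a [::] b 0 isT.
  by rewrite word_pairs_rcons /= word_nil mul1r !mulrA expr1 -exprSr.
- apply: done1; rewrite -[_ * x]mulr1 -(expr0 y).
  by apply: xform_pairs_xy; rewrite /positive_pairs all_rcons.
- apply: done0; rewrite word_pairs_rcons /= [z ^+ c.+1]exprSr.
  by rewrite -!mulrA rel3 !mulr0.
- by apply: done1; have := @xform_pairs a l b c.+1 hl;
    rewrite !word_pairs_rcons /= [z ^+ c.+2]exprSr !mulrA.
- apply: done0; rewrite -mulrA relyXx [x ^+ b.+1]exprS -!scalerAr -!mulrA.
  move: hl; rewrite /positive_pairs all_rcons => /andP[/andP[_ h] _].
  by rewrite pairs_last_xx // mulr0 scaler0.
- by apply: done1; rewrite -mulrA -exprSr; apply: xform_pairs_xy.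
- case: b => [|b]; first by apply: done0; rewrite mulr1 -mulrA rel2 mulr0.
  apply: done1; have := @xform_pairs a (rcons l q) b 0 hl.
  by rewrite [in word _ _]word_pairs_rcons /= !mulrA expr1.
Qed.

Lemma word_xform s : exists c w, word ltr (X :: s) = c *: w /\ xform w.
Proof.
elim/last_ind: s => [|s i [c [w [e hw]]]].
  exists 1, (x ^+ 1 * y ^+ 0); split; last exact: xform_xy.
  by rewrite word_cons word_nil scale1r.
have [d [w' [e' hw']]] := xform_rcons i hw.
exists (c * d), w'; split => //.
rewrite -rcons_cons -cats1 word_cat [word _ [:: i]]word_cons word_nil mulr1 e.
by rewrite -scalerAl e' scalerA.
Qed.

Context {W : lmodType k} (f : {linear A -> W}).
Hypothesis f_comm : forall a b : A, f (a * b) = f (b * a).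
Hypothesis f1 : f 1 = 0.
Hypothesis f_power : forall i n, (0 < n)%N -> f (ltr i ^+ n) = 0.
Hypothesis f_pairs : forall l : seq (nat * nat), l != [::] -> positive_pairs l ->
  f (word ltr (pairs_word l)) = 0.

(** Rotation moves $x^{n+1}$ behind $zx$, which creates the zero factor $zxx$. *)
Lemma f_xzx n u : f (x ^+ n.+1 * (u * z * x)) = 0.
Proof.
rewrite f_comm exprS -!mulrA [x * (x * _)]mulrA [z * (x * x * _)]mulrA.
by rewrite [z * (x * x)]mulrA relzxx mul0r mulr0 linear0.
Qed.

(** In the first form, rotation and $y^b x = ± x^{b+1}$ leave a power of $x$. The second is a
    product of blocks if $a = 0$. The remaining cases only use that a product of blocks starts with
    $x$ and ends with $z$: up to sign they rotate to the shape of [f_xzx]. *)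
Lemma f_xform u : xform u -> f u = 0.
Proof.
case=> [a b|a l b c hl|a l q b hl].
- rewrite f_comm exprS mulrA relyXx -scalerAl -exprD linearZ /=.
  by rewrite f_power ?scaler0.
- case: a => [|a].
    rewrite mul1r f_pairs //; first by case: (l).
    by rewrite /positive_pairs all_rcons.
  have [t ->] := @pairs_word_xz l (b.+1, c.+1) isT.
  by rewrite mulrA -exprSr exprS -mulrA f_comm -mulrA f_xzx.
- have hq : (0 < q.2)%N.
    by move: hl; rewrite /positive_pairs all_rcons => /andP[/andP[]].
  have [t ->] := pairs_word_xz l hq.
  rewrite f_comm !mulrA -[y ^+ b * _ * x]mulrA -exprSr exprS mulrA relyXx.
  rewrite -!scalerAl -exprD -!mulrA [t * _]mulrA linearZ /= addSn f_xzx.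
  exact: scaler0.
Qed.

(** A word containing $x$ is rotated to start with $x$, where [word_xform] applies. Without $x$, the
    relation $zy = 0$ reduces it to a scalar times $y^b z^a$. *)
Lemma f_word s : f (word ltr s) = 0.
Proof.
have [/(nthP X)[i si eX]|nX] := boolP (X \in s).
  rewrite -(cat_take_drop i s) (drop_nth X si) eX word_cat f_comm -word_cat.
  have [c [w [e hw]]] := word_xform (drop i.+1 s ++ take i s).
  by rewrite -cat_cons in e; rewrite e linearZ /= f_xform // scaler0.
suff [c [b [a ->]]] : exists (c : k) b a, word ltr s = c *: (y ^+ b * z ^+ a).
  rewrite linearZ /=; case: a b => [|a] [|b].
  - by rewrite mul1r f1 scaler0.
  - by rewrite mulr1 f_power // scaler0.
  - by rewrite mul1r f_power // scaler0.
  (* When both $y$ and $z$ occur, rotation creates the factor $zy$. *)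
  - rewrite f_comm exprSr exprS mulrA -[_ * z * y]mulrA rel3 mulr0 mul0r.
    by rewrite linear0 scaler0.
elim/last_ind: s nX => [|s i IH].
  by exists 1, 0, 0; rewrite word_nil !mul1r scale1r.
rewrite mem_rcons inE negb_or => /andP[iX /IH[c [b [a e]]]].
rewrite -cats1 word_cat [word _ [:: i]]word_cons word_nil mulr1 e.
rewrite -scalerAl -mulrA.
have [->|->] : i = Y \/ i = Z.
  by case: i iX => -[|[|[|//]]] hi // _; [left|right]; apply: val_inj.
- case: a {e} => [|a]; last first.
    by exists 0, 0, 0; rewrite exprSr -mulrA rel3 !mulr0 scaler0 scale0r.
  by exists c, b.+1, 0; rewrite mul1r mulr1 exprSr.
- by exists c, b, a.+1; rewrite exprSr.
Qed.

End Traces.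

(** * Representatives of homology classes *)

Section HomologyClasses.
Context {k : fieldType} {U V W : lmodType k}.
Context (f : {linear U -> V}) (g : {linear V -> W}).

Lemma hcls_surj (q : homology f g) : exists c (gc : g c = 0), q = hcls f gc.
Proof.
rewrite (lcls_surj q); case: (repr q) => c hc.
exists c, (eqP hc); congr lcls; exact: val_inj.
Qed.

Lemma hcls_eq c c' (gc : g c = 0) (gc' : g c' = 0) u :
  c = c' + f u -> hcls f gc = hcls f gc'.
Proof.
move=> e; apply/lcls_eq; rewrite -[_ - _]addr0 -[_ - _]scale1r.
constructor; last by constructor.
by exists u; rewrite linearB /= e addrC addKr.
Qed.

(** Boundaries already form a subspace, so taking their span in [homology] adds nothing. *)
Lemma hcls_eq0 c (gc : g c = 0) : hcls f gc = 0 -> exists u, f u = c.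
Proof.
have h d : in_lspan (@is_boundary k U V W f g) d -> exists u, f u = val d.
  elim=> [|t e d' [u fu] _ [u' fu']]; first by exists 0; rewrite linear0.
  by exists (t *: u + u'); rewrite linearP /= fu fu'.
rewrite -(linear0 (lcls (@is_boundary k U V W f g))) => /lcls_eq.
by rewrite subr0 => /h.
Qed.

End HomologyClasses.

Section HomologyMapClasses.
Context {k : fieldType} {U V W U' V' W' : lmodType k}.
Context (f : {linear U -> V}) (g : {linear V -> W}).
Context (f' : {linear U' -> V'}) (g' : {linear V' -> W'}).
Context (phi : {linear V -> V'}).
Hypothesis phi_cycle : forall v, g v = 0 -> g' (phi v) = 0.
Hypothesis phi_boundary : forall u, exists u', f' u' = phi (f u).

Lemma homology_map_hcls c (gc : g c = 0) :
  homology_map phi_cycle phi_boundary (hcls f gc) = hcls f' (phi_cycle gc).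
Proof.
by rewrite /homology_map lquot_liftE; congr lcls; apply: val_inj.
Qed.

End HomologyMapClasses.

(** * The comparison map on $HH_1$ and the values of Connes' differential *)

Section KoszulComparison.
Context {k : fieldType} {A : algType k} (ltr : letter -> A).
Hypothesis rel1 : (ltr X + ltr Y) * ltr X = 0.
Hypothesis rel2 : ltr X * ltr Z = 0.
Hypothesis rel3 : ltr Z * ltr Y = 0.
Hypothesis words_span : forall P : A -> Prop, P 0 ->
  (forall c a b, P a -> P b -> P (c *: a + b)) -> (forall s, P (word ltr s)) ->
  forall a, P a.

Local Notation iota := (koszul_to_HH1 rel1 rel2 rel3).

Lemma koszul_to_HH1_surj q : exists p, iota p = q.
Proof.
have [c [gc ->]] := hcls_surj q.
have [w [u e]] := koszul_incl_bar_decomp words_span c.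
(* The chain [w] is a Koszul cycle because its image differs from the cycle [c] by a boundary. *)
have d1w : d1 ltr w = 0.
  have : b1 (koszul_incl ltr w) = 0.
    have -> : koszul_incl ltr w = c - b2 u by rewrite e addrK.
    have -> : b1 (c - b2 u) = b1 c - b1 (b2 u) :> A by exact: linearB.
    by rewrite gc b1b2 subrr.
  by rewrite b1_koszul_incl.
exists (hcls (d2 ltr) d1w); rewrite /koszul_to_HH1 homology_map_hcls.
by apply/esym; apply: hcls_eq e.
Qed.

(** The chain-level premise is what [koszul_incl_boundary_inv] supplies from a presentation of the
    algebra. *)
Lemma koszul_to_HH1_inj :
  (forall w u, koszul_incl ltr w = b2 u -> exists u', d2 ltr u' = w) ->
  injective iota.
Proof.
move=> incl_inv p q e; apply/eqP; rewrite -subr_eq0; apply/eqP.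
have : iota (p - q) = 0 by rewrite linearB /= e subrr.
have [c [gc ->]] := hcls_surj (p - q).
rewrite /koszul_to_HH1 homology_map_hcls => h.
have [u e'] := hcls_eq0 h; have [u' eu'] := incl_inv _ _ (esym e').
by apply: lcls_eq0; exists u'.
Qed.

(** By [letter_chain_bar] with coefficient 1, the chain $1 ⊗ s$ is homologous to the image of
    [theta_chain]. *)
Lemma connes0_word s :
  connes0 (HH0_cls (word ltr s)) = iota (hcls (d2 ltr) (theta_cycle ltr s)).
Proof.
rewrite /connes0 lquot_liftE /koszul_to_HH1 homology_map_hcls.
have [u e] := letter_chain_bar ltr 1 s.
by apply: (@hcls_eq _ _ _ _ _ _ _ _ _ _ u); rewrite -letter_chain_theta.
Qed.

(** All $n$ factorizations of the word contribute the same summand, whence the factor $n$. *)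
Lemma theta_chain_nseq n i :
  theta_chain ltr (nseq n i) = n%:R *: (ltr i ^+ n.-1 ⊗ V1_basis i).
Proof.
transitivity (\sum_(j < size (nseq n i))
    (ltr i ^+ n.-1 ⊗ V1_basis i : tensor A V1)).
  apply: eq_bigr => j _.
  have jn : (j < n)%N by have := ltn_ord j; rewrite {2}size_nseq.
  rewrite (tnth_nth X) /= nth_nseq jn drop_nseq take_nseq ?(ltnW jn) //.
  by rewrite word_cat !word_nseq -exprD addnC; congr (_ ^+ _ ⊗ _); lia.
by rewrite sumr_const card_ord size_nseq scaler_nat.
Qed.

Lemma connes0_power n i : connes0 (HH0_cls (ltr i ^+ n)) =
  n%:R *: iota (hcls (d2 ltr) (power_cycle ltr i n)).
Proof.
rewrite -word_nseq connes0_word -linearZ; congr (iota _).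
rewrite -linearZ; congr lcls; apply: val_inj => /=; exact: theta_chain_nseq.
Qed.

End KoszulComparison.

(** * Passage to the algebra $A$ and its listed elements *)

Lemma pairs_word_eps_word (l : seq (nat * nat)) :
  pairs_word l = eps_word (fun i => (tnth (in_tuple l) i).1)
                          (fun i => (tnth (in_tuple l) i).2).
Proof.
rewrite /pairs_word /eps_word; congr flatten.
transitivity (map pair_word (map (tnth (in_tuple l)) (enum 'I_(size l)))).
  by rewrite map_tnth_enum.
by rewrite -map_comp.
Qed.

Lemma inj_surj_bij (T U : Type) (f : T -> U) :
  injective f -> (forall u, exists t, f t = u) -> bijective f.
Proof.
move=> fi fs; exists (fun u => projT1 (cid (fs u))) => u; last by case: cid.
by apply: fi; case: cid.
Qed.

Lemma HH0_cls_comm (k : fieldType) (A : algType k) (a b : A) :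
  HH0_cls (a * b) = HH0_cls (b * a).
Proof.
apply/lcls_eq; rewrite -[_ - _]addr0 -[_ - _]scale1r.
by constructor; [exists a, b | constructor].
Qed.

Section Instance.
Context (k : fieldType).

Definition A_pi : {lrmorphism freeA k -> A k} := aq_pi (@freeA_proper k).

Definition A_lift (a : A k) : freeA k :=
  repr (a : lquot (ideal_gen (relators (@gen k)))).

Lemma A_liftK : cancel A_lift A_pi.
Proof. by move=> a; rewrite [RHS]aq_surj. Qed.

Lemma A_pi_ker f : A_pi f = 0 <-> in_lspan (ideal_gen (relators (@gen k))) f.
Proof.
have e := aq_eq (@freeA_proper k) f 0; rewrite subr0 in e.
have pi0 : aq_pi (@freeA_proper k) 0 = 0 by exact: linear0.
by rewrite pi0 in e.
Qed.

Lemma A_words_span (P : A k -> Prop) : P 0 ->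
  (forall c a b, P a -> P b -> P (c *: a + b)) ->
  (forall s, P (word (xyz k) s)) -> forall a, P a.
Proof. exact: words_span A_liftK P. Qed.

Lemma koszul_to_bar_bij : bijective (@koszul_to_bar k).
Proof.
apply: inj_surj_bij.
  apply: koszul_to_HH1_inj => w u.
  exact: (koszul_incl_boundary_inv A_liftK A_pi_ker).
apply: koszul_to_HH1_surj; exact: A_words_span.
Qed.

End Instance.

(** * Values and uniqueness of $B_0$ *)

Theorem proposition5p8 (k : fieldType) (hk : [pchar k] =i pred0) :
  let v := xyz k in
  let values (B : HH0 (A k) -> HH1 (A k)) : Prop :=
    [/\ forall n : nat, (0 < n)%N ->
          [/\ B (alpha0 v n) = n%:R *: koszul_to_bar (alpha1 v n),
              B (beta0 v n) = n%:R *: koszul_to_bar (beta1 v n)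
            & B (gamma0 v n) = n%:R *: koszul_to_bar (gamma1 v n)],
        forall (p : nat) (n m : 'I_p -> nat), (0 < p)%N ->
          (forall i, (0 < n i)%N) -> (forall i, (0 < m i)%N) ->
          B (eps0 v n m) = koszul_to_bar (theta1 v n m)
      & B zeta0 = 0] in
  [/\ bijective (@koszul_to_bar k),
      values (@connes0 k (A k))
    & forall B : {linear HH0 (A k) -> HH1 (A k)},
        values B -> B =1 @connes0 k (A k)].
Proof.
have r1 : (xyz k X + xyz k Y) * xyz k X = 0 by exact: relators1.
have r2 : xyz k X * xyz k Z = 0 by exact: relators2.
have r3 : xyz k Z * xyz k Y = 0 by exact: relators3.
have connes1 : @connes0 k (A k) zeta0 = 0.
  (* The chain $1 ⊗ \bar 1$ is itself zero, so it bounds the zero chain. *)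
  rewrite /zeta0 /connes0 lquot_liftE; apply: lcls_eq0; exists 0.
  by rewrite linear0 /= /connes_chain bar1 tens0r.
split; first exact: koszul_to_bar_bij.
- split=> [n _|p n m _ _ _|]; last exact: connes1.
  + by split; exact: connes0_power.
  + exact: connes0_word.
move=> B [Bpow Beps Bone] q; rewrite (lcls_surj q); move: (repr q) => a.
(* The difference of the two maps, pulled back to $A$, is a trace vanishing on all listed elements,
   so [f_word] makes it vanish on every word. *)
pose f := (B \o @HH0_cls k (A k)) \- (@connes0 k (A k) \o @HH0_cls k (A k)).
apply/eqP; rewrite -subr_eq0 -[_ - _]/(f a); apply/eqP; move: a.
apply: A_words_span => [|c a b fa fb|s]; first exact: linear0.
  apply: etrans (linearP f c a b) _.
  apply: etrans (congr2 (fun p q => c *: p + q) fa fb) _.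
  by rewrite addr0 scaler0.
apply: (f_word r1 r2 r3) => [a b||i n n0|l l0 lp].
- exact: (congr1 (fun q => B q - @connes0 k (A k) q) (HH0_cls_comm a b)).
- by rewrite /f /= -/zeta0 Bone connes1 subrr.
- have [eX eY eZ] := Bpow n n0.
  rewrite /f /= (connes0_power r1 r2 r3); apply/eqP; rewrite subr_eq0; apply/eqP.
  by case: i => -[|[|[|//]]] hi; [have -> : Ordinal hi = X by exact: val_inj
    | have -> : Ordinal hi = Y by exact: val_inj
    | have -> : Ordinal hi = Z by exact: val_inj].
- rewrite /f /= (connes0_word r1 r2 r3) pairs_word_eps_word.
  apply/eqP; rewrite subr_eq0; apply/eqP; apply: Beps.
  + by case: l l0 {lp}.
  + move=> i; move/allP: lp => /(_ _ (mem_tnth i (in_tuple l))) /andP[] //.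
  + move=> i; move/allP: lp => /(_ _ (mem_tnth i (in_tuple l))) /andP[] //.
Qed.
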